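(* Let $A:\mathbb{R}^n\to\mathbb{R}^m$ be linear, let $f:\mathbb{R}^n\to\mathbb{R}\cup\{\infty\}$ be proper, closed and strongly convex with modulus $\mu_f>0$, let $g:\mathbb{R}^m\to\mathbb{R}\cup\{\infty\}$ be proper, closed and convex, with $A\,\mathrm{dom}\, f\cap\mathrm{dom}\, g\neq\emptyset$. Let $\psi(y)=f^*(-A^\top y)+g^*(y)$. For any $\gamma>0$ the function $\psi_\gamma(y)=-\mathcal{L}_\gamma(x(y),z_\gamma(y),y)$ is strictly continuous on $\mathbb{R}^m$ and satisfies, for every $y\in\mathbb{R}^m$, (i) $\psi_\gamma(y)\le\psi(y)-\frac{\gamma}{2}\|Ax(y)-z_\gamma(y)\|^2$; (ii) $\psi_\gamma(y)\ge\psi(T_\gamma(y))+\frac{\gamma}{2}\Bigl(1-\frac{\gamma\|A\|^2}{\mu_f}\Bigr)\|Ax(y)-z_\gamma(y)\|^2$. In particular, if $\gamma<\mu_f/\|A\|^2$, then also (iii) $\inf\psi_\gamma=\inf\psi$ and $\arg\min\psi_\gamma=\arg\min\psi$.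
   Context: $\langle\cdot,\cdot\rangle$ is an inner product with induced norm $\|\cdot\|$; $\|A\|$ is the operator norm, $A^\top$ the adjoint; $h^*$ is the Fenchel conjugate of $h$; strong convexity of $f$ with modulus $\mu_f$ means $f-\frac{\mu_f}{2}\|\cdot\|^2$ is convex. The augmented Lagrangian is $\mathcal{L}_\gamma(x,z,y)=f(x)+g(z)+\langle y,Ax-z\rangle+\frac{\gamma}{2}\|Ax-z\|^2$. Define $x(y)=\arg\min_x\{f(x)+\langle y,Ax\rangle\}=\nabla f^*(-A^\top y)$, $z_\gamma(y)=\arg\min_z\mathcal{L}_\gamma(x(y),z,y)$, and $T_\gamma(y)=y+\gamma(Ax(y)-z_\gamma(y))$. A map $F$ is strictly continuous at $\bar x$ if $\limsup_{(x,y)\to(\bar x,\bar x),\,x\ne y}\|F(y)-F(x)\|/\|y-x\|<\infty$ (i.e. it is Lipschitz near $\bar x$), and strictly continuous on $\mathbb{R}^m$ if this holds at every point. *)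

(* Defs.v *)
From mathcomp Require Import all_boot all_order all_algebra.
From mathcomp Require Import all_classical all_reals all_analysis.

Set Implicit Arguments.
Unset Strict Implicit.
Unset Printing Implicit Defensive.

Import Order.TTheory GRing.Theory Num.Theory.
Import numFieldNormedType.Exports.

Local Open Scope classical_set_scope.
Local Open Scope ring_scope.

(* Inner products on R^n are arbitrary, not only the standard one, and are the
   positive definite symmetric bilinear forms [{dot 'cV[R]_n for idfun}].  All
   norms below are induced by such forms; the norm [`|x|] that the library puts
   on matrices is the sup norm, and only its topology is used. *)
Definition ipnorm (R : realType) (n : nat) (ip : {dot 'cV[R]_n for idfun})
  (x : 'cV[R]_n) : R := Num.sqrt (ip x x).

Definition opnorm (R : realType) (n m : nat)
    (ipn : {dot 'cV[R]_n for idfun}) (ipm : {dot 'cV[R]_m for idfun})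
    (A : {linear 'cV[R]_n -> 'cV[R]_m}) : R :=
  sup [set ipnorm ipm (A x) | x in [set x | ipnorm ipn x <= 1]].

(* [adjoint ipn ipm A y] is the unique v with <A x, y> = <x, v> for all x. *)
Definition adjoint (R : realType) (n m : nat)
    (ipn : {dot 'cV[R]_n for idfun}) (ipm : {dot 'cV[R]_m for idfun})
    (A : {linear 'cV[R]_n -> 'cV[R]_m}) (y : 'cV[R]_m) : 'cV[R]_n :=
  get [set v | forall x, ipm (A x) y = ipn x v].

Section ExtendedRealFunctions.
Variables (R : realType) (n : nat).
Implicit Types (ip : {dot 'cV[R]_n for idfun}) (h : 'cV[R]_n -> \bar R).

Definition dom h : set 'cV[R]_n := [set x | (h x < +oo)%E].

(* Includes the requirement that h takes its values in R \cup {+oo}. *)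
Definition proper_fun h : Prop := (forall x, h x != -oo%E) /\ dom h !=set0.

Definition closed_fun h : Prop :=
  closed [set p : 'cV[R]_n * R | (h p.1 <= p.2%:E)%E].

(* Used for h > -oo only, where no sum +oo - oo occurs; recall 0 * +oo = 0. *)
Definition convex_fun h : Prop :=
  forall (x y : 'cV[R]_n) (t : R), 0 <= t <= 1 ->
    (h (t *: x + (1 - t) *: y)%R
       <= t%:E * h x + (1 - t)%:E * h y)%E.

Definition strongly_convex_fun ip (mu : R) h : Prop :=
  convex_fun (fun x => (h x - (mu / 2 * ipnorm ip x ^+ 2)%:E)%E).

Definition conjugate_fun ip h (y : 'cV[R]_n) : \bar R :=
  ereal_sup (range (fun x => ((ip x y)%:E - h x)%E)).

Definition argmin h : set 'cV[R]_n := [set x | forall y, (h x <= h y)%E].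

Definition strictly_continuous_at ip (F : 'cV[R]_n -> R) (x0 : 'cV[R]_n)
    : Prop :=
  (limf_esup
     (fun p : 'cV[R]_n * 'cV[R]_n =>
        (`|F p.2 - F p.1| / ipnorm ip (p.2 - p.1))%:E)
     (within [set p | p.1 <> p.2] (nbhs (x0, x0)))
   < +oo)%E.

Definition strictly_continuous ip (F : 'cV[R]_n -> R) : Prop :=
  forall x0, strictly_continuous_at ip F x0.

End ExtendedRealFunctions.

Section AlternatingMinimization.
Variables (R : realType) (n m : nat).
Variables (ipn : {dot 'cV[R]_n for idfun}) (ipm : {dot 'cV[R]_m for idfun}).
Variable A : {linear 'cV[R]_n -> 'cV[R]_m}.
Variables (f : 'cV[R]_n -> \bar R) (g : 'cV[R]_m -> \bar R).

Definition psi (y : 'cV[R]_m) : \bar R :=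
  (conjugate_fun ipn f (- adjoint ipn ipm A y)%R + conjugate_fun ipm g y)%E.

Definition aug_lagrangian (gamma : R) (x : 'cV[R]_n) (z y : 'cV[R]_m)
    : \bar R :=
  (f x + g z + (ipm y (A x - z))%:E
     + (gamma / 2 * ipnorm ipm (A x - z) ^+ 2)%:E)%E.

(* The two minimizers are selected by [get]; they exist and are unique when f
   is proper, closed and strongly convex, g is proper, closed and convex, and
   gamma > 0. *)
Definition xmin (y : 'cV[R]_m) : 'cV[R]_n :=
  get (argmin (fun x => (f x + (ipm y (A x))%:E)%E)).

Definition zmin (gamma : R) (y : 'cV[R]_m) : 'cV[R]_m :=
  get (argmin (fun z => aug_lagrangian gamma (xmin y) z y)).

Definition residual (gamma : R) (y : 'cV[R]_m) : 'cV[R]_m :=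
  A (xmin y) - zmin gamma y.

Definition Tmap (gamma : R) (y : 'cV[R]_m) : 'cV[R]_m :=
  y + gamma *: residual gamma y.

Definition psi_env (gamma : R) (y : 'cV[R]_m) : \bar R :=
  (- aug_lagrangian gamma (xmin y) (zmin gamma y) y)%E.

End AlternatingMinimization.

(* Main.v *)
(** Write
    [F y = f^*(-A^T y) = -(f (x y) + <y, A (x y)>)]; then
    [psi_gamma y = F y + (<y, z y> - g (z y)) - gamma/2 |A (x y) - z y|^2],
    and (i) is the Fenchel-Young inequality for [g].  For (ii), optimality of
    [z y] says that [T y] is a subgradient of [g] at [z y], which makes
    Fenchel-Young an equality at [T y], while strong convexity of [f] gives [F]
    the quadratic upper model with gradient [-A (x y)] and constant
    [|A|^2 / mu].  Under the bound on [gamma],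
    [psi (T y) <= psi_gamma y <= psi y], with equality on the left only if
    [T y = y], which yields (iii).  The minimizers are Lipschitz in [y], whence
    the strict continuity of [psi_gamma].  *)

Require Import Defs.
From mathcomp Require Import all_boot all_order all_algebra.
From mathcomp Require Import all_classical all_reals all_analysis.
From mathcomp Require Import ring lra.

Set Implicit Arguments.
Unset Strict Implicit.

Import Order.TTheory GRing.Theory Num.Theory.
Import numFieldNormedType.Exports.
Local Open Scope classical_set_scope.
Local Open Scope ring_scope.

Lemma cV_sum_delta (R : nzRingType) n (x : 'cV[R]_n) :
  x = \sum_i x i 0 *: delta_mx i 0.
Proof.
by rewrite {1}[x]matrix_sum_delta; apply: eq_bigr => i _; rewrite big_ord1.
Qed.

(** * Arbitrary inner products on column vectors *)

Section InnerProduct.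
Variables (R : realType) (n : nat) (ip : {dot 'cV[R]_n for idfun}).
Implicit Types (x y z u v : 'cV[R]_n) (a : R).

Lemma ipC x y : ip x y = ip y x.
Proof. by rewrite hermC expr0 mul1r. Qed.

Lemma ipZl a x y : ip (a *: x) y = a * ip x y.
Proof. by rewrite linearZl_LR. Qed.

Lemma ipZr a x y : ip x (a *: y) = a * ip x y.
Proof. by rewrite ipC ipZl ipC. Qed.

Lemma ipDl x y z : ip (x + y) z = ip x z + ip y z.
Proof. by rewrite linearDl. Qed.

Lemma ipDr x y z : ip x (y + z) = ip x y + ip x z.
Proof. by rewrite linearDr. Qed.

Lemma ipNl x y : ip (- x) y = - ip x y.
Proof. by rewrite linearNl. Qed.

Lemma ipNr x y : ip x (- y) = - ip x y.
Proof. by rewrite linearNr. Qed.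

Lemma ip0l x : ip 0 x = 0.
Proof. by rewrite linear0l. Qed.

Lemma ip0r x : ip x 0 = 0.
Proof. by rewrite linear0r. Qed.

Lemma ip_suml I (r : seq I) (F : I -> 'cV[R]_n) x :
  ip (\sum_(i <- r) F i) x = \sum_(i <- r) ip (F i) x.
Proof. by apply: (big_morph (ip^~ x)) => [y z|]; rewrite ?ipDl ?ip0l. Qed.

Definition ipE := (ipDl, ipDr, ipNl, ipNr, ipZl, ipZr).

Lemma ip_ge0 x : 0 <= ip x x.
Proof. by have [->|/neq0_dnorm_gt0/ltW//] := eqVneq x 0; rewrite ip0l. Qed.

Lemma ip_eq0 x : ip x x = 0 -> x = 0.
Proof.
by move=> ipx0; apply/eqP/negPn/negP => /(neq0_dnorm_gt0 (s := ip)); rewrite ipx0 ltxx.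
Qed.

Lemma ipnorm_ge0 x : 0 <= ipnorm ip x.
Proof. exact: sqrtr_ge0. Qed.

Lemma sqr_ipnorm x : ipnorm ip x ^+ 2 = ip x x.
Proof. by rewrite sqr_sqrtr ?ip_ge0. Qed.

Lemma ipnorm0 : ipnorm ip 0 = 0.
Proof. by rewrite /ipnorm ip0l sqrtr0. Qed.

Lemma ipnormN x : ipnorm ip (- x) = ipnorm ip x.
Proof. by rewrite /ipnorm ipNl ipNr opprK. Qed.

Lemma ipnormB x y : ipnorm ip (x - y) = ipnorm ip (y - x).
Proof. by rewrite -opprB ipnormN. Qed.

Lemma ipnormZ a x : ipnorm ip (a *: x) = `|a| * ipnorm ip x.
Proof. by rewrite /ipnorm ipZl ipZr mulrA -expr2 sqrtrM ?sqr_ge0// sqrtr_sqr. Qed.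

Lemma ipnorm_eq0 x : ipnorm ip x = 0 -> x = 0.
Proof. by move=> x0; apply: ip_eq0; rewrite -sqr_ipnorm x0 expr0n. Qed.

(** With [a], [b] the norms of [x], [y], the squared norm of [b *: x - a *: y] is
    [2 a b (a b - <x, y>)]. *)
Lemma cauchy_schwarz x y : ip x y <= ipnorm ip x * ipnorm ip y.
Proof.
have [x0|xN0] := eqVneq (ipnorm ip x) 0.
  by rewrite x0 mul0r (ipnorm_eq0 x0) ip0l.
have [y0|yN0] := eqVneq (ipnorm ip y) 0.
  by rewrite y0 mulr0 (ipnorm_eq0 y0) ip0r.
have x_gt0 : 0 < ipnorm ip x by rewrite lt_def xN0 ipnorm_ge0.
have y_gt0 : 0 < ipnorm ip y by rewrite lt_def yN0 ipnorm_ge0.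
have := ip_ge0 (ipnorm ip y *: x - ipnorm ip x *: y).
rewrite !ipE -!sqr_ipnorm (ipC y x).
set a := ipnorm ip x in x_gt0 *; set b := ipnorm ip y in y_gt0 *.
move=> H.
have : 0 <= (2 * a * b) * (a * b - ip x y) by move: H; nra.
by rewrite pmulr_rge0 ?subr_ge0// !mulr_gt0.
Qed.

Lemma ipnormD x y : ipnorm ip (x + y) <= ipnorm ip x + ipnorm ip y.
Proof.
rewrite -(ler_pXn2r (n := 2)) ?nnegrE ?addr_ge0 ?ipnorm_ge0//.
rewrite sqr_ipnorm !ipE sqrrD !sqr_ipnorm (ipC y x).
by have := cauchy_schwarz x y; lra.
Qed.

Lemma ler_ipnormB x y : ipnorm ip (x - y) <= ipnorm ip x + ipnorm ip y.
Proof. by rewrite -(ipnormN y) ipnormD. Qed.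

Lemma ipnorm_sub_le x y : ipnorm ip x <= ipnorm ip y + ipnorm ip (x - y).
Proof. by rewrite -{1}(subrK y x) addrC ipnormD. Qed.

(** The Gram matrix [G] of the standard basis is invertible: a kernel vector is orthogonal to every
    basis vector, hence to itself. The representing vector solves [G v = (l e_i)_i]. *)
Lemma riesz (l : 'cV[R]_n -> R) :
  (forall a x y, l (a *: x + y) = a * l x + l y) ->
  exists v, forall x, l x = ip x v.
Proof.
move=> lP.
have l0 : l 0 = 0 by have := lP (-1) 0 0; rewrite scaler0 addr0; lra.
have lD x y : l (x + y) = l x + l y by have := lP 1 x y; rewrite scale1r mul1r.
have lZ a x : l (a *: x) = a * l x by have := lP a x 0; rewrite l0 !addr0.
pose e (i : 'I_n) : 'cV[R]_n := delta_mx i 0.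
pose G : 'M[R]_n := \matrix_(i, j) ip (e i) (e j).
have dec x : x = \sum_i x i 0 *: e i by exact: cV_sum_delta.
have GT : G^T = G by apply/matrixP => i j; rewrite !mxE ipC.
have mulG x i : (G *m x) i 0 = ip (e i) x.
  rewrite mxE [in RHS](dec x) ipC ip_suml; apply: eq_bigr => j _.
  by rewrite ipZl ipC mxE mulrC.
have Gunit : G \in unitmx.
  rewrite -row_free_unit -kermx_eq0; apply/eqP/row_matrixP => i.
  rewrite row0; set r := row i _.
  have /(congr1 trmx) : r *m G = 0 by rewrite -row_mul mulmx_ker row0.
  rewrite trmx_mul GT trmx0 => Gr0.
  apply: trmx_inj; rewrite trmx0; apply: ip_eq0.
  rewrite {1}(dec r^T) ip_suml big1// => j _.
  by rewrite ipZl -mulG Gr0 [X in _ * X]mxE mulr0.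
exists (invmx G *m \col_i l (e i)) => x.
rewrite [in LHS](dec x) [in RHS](dec x) (big_morph l lD l0) ip_suml.
by apply: eq_bigr => i _; rewrite lZ ipZl -mulG mulmxA mulmxV// mul1mx [in RHS]mxE.
Qed.

(** Each coordinate is an inner product with a fixed vector, so Cauchy-Schwarz bounds it. This half
    of the norm equivalence ties [ip] to the topology of the sup norm. *)
Lemma mx_norm_le_ipnorm : exists2 C, 0 < C & forall x, `|x| <= C * ipnorm ip x.
Proof.
have rep (i : 'I_n) : exists v, forall x, x i 0 = ip x v.
  by apply: (riesz (l := fun x => x i 0)) => a x y; rewrite !mxE.
have [v vP] := choice rep.
pose C := 1 + \sum_i ipnorm ip (v i).
have C_gt0 : 0 < C by rewrite ltr_wpDr// sumr_ge0// => i _; exact: ipnorm_ge0.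
exists C => // x; rewrite [leLHS]mx_normrE; apply/bigmax_leP; split.
  by rewrite mulr_ge0 ?ipnorm_ge0// ltW.
move=> [i j] _ /=; rewrite ord1 vP.
have vC : ipnorm ip (v i) <= C.
  rewrite /C (bigD1 i)//= addrA (addrC 1) -addrA lerDl addr_ge0//.
  by rewrite sumr_ge0// => k _; exact: ipnorm_ge0.
have := cauchy_schwarz x (v i); have := cauchy_schwarz (- x) (v i).
rewrite ipnormN ipNl => h1 h2.
apply: (@le_trans _ _ (ipnorm ip x * ipnorm ip (v i))).
  by rewrite ler_norml h2 andbT lerNl.
by rewrite mulrC ler_wpM2r ?ipnorm_ge0.
Qed.

End InnerProduct.

(** * Operator norm and adjoint *)

Section OperatorNorm.
Variables (R : realType) (n m : nat).
Variables (ipn : {dot 'cV[R]_n for idfun}) (ipm : {dot 'cV[R]_m for idfun}).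
Variable A : {linear 'cV[R]_n -> 'cV[R]_m}.

Lemma ipnorm_linear_le_mx_norm :
  exists2 C, 0 < C & forall x, ipnorm ipm (A x) <= C * `|x|.
Proof.
pose e (i : 'I_n) : 'cV[R]_n := delta_mx i 0.
pose C := 1 + \sum_i ipnorm ipm (A (e i)).
have C_gt0 : 0 < C by rewrite ltr_wpDr// sumr_ge0// => i _; exact: ipnorm_ge0.
exists C => // x.
apply: (@le_trans _ _ (\sum_i `|x| * ipnorm ipm (A (e i)))); last first.
  by rewrite -mulr_sumr mulrC ler_wpM2r// lerDr.
rewrite {1}[x]cV_sum_delta linear_sum; elim/big_ind2 : _ => [|a b c d ab cd|i _].
- by rewrite ipnorm0.
- exact: le_trans (ipnormD _ _ _) (lerD ab cd).
- rewrite linearZ ipnormZ ler_wpM2r ?ipnorm_ge0// [leRHS]mx_normrE.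
  by apply: (le_bigmax _ (fun ij : 'I_n * 'I_1 => `|x ij.1 ij.2|) (i, 0)).
Qed.

(** The supremum is a genuine one because the image of the unit ball is bounded; the bound passes
    through the sup norm. *)
Lemma opnorm_ge x : ipnorm ipn x <= 1 -> ipnorm ipm (A x) <= opnorm ipn ipm A.
Proof.
move=> x1; apply: ub_le_sup; last by exists x.
have [C C0 CP] := ipnorm_linear_le_mx_norm.
have [D D0 DP] := mx_norm_le_ipnorm ipn.
exists (C * D) => _ [y /= y1 <-]; apply: le_trans (CP _) _.
rewrite ler_pM2l//; apply: le_trans (DP _) _.
by rewrite ler_piMr// ltW.
Qed.

Lemma opnorm_ge0 : 0 <= opnorm ipn ipm A.
Proof. by apply: le_trans (opnorm_ge (x := 0) _); rewrite ?ipnorm_ge0// ipnorm0. Qed.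

Lemma ipnorm_linear_le_opnorm x :
  ipnorm ipm (A x) <= opnorm ipn ipm A * ipnorm ipn x.
Proof.
have [x0|xN0] := eqVneq (ipnorm ipn x) 0.
  by rewrite x0 mulr0 (ipnorm_eq0 x0) linear0 ipnorm0.
have x_gt0 : 0 < ipnorm ipn x by rewrite lt_def xN0 ipnorm_ge0.
rewrite -ler_pdivrMr//.
have -> : ipnorm ipm (A x) / ipnorm ipn x
    = ipnorm ipm (A ((ipnorm ipn x)^-1 *: x)).
  by rewrite linearZ ipnormZ ger0_norm ?invr_ge0 ?ipnorm_ge0// mulrC.
by apply: opnorm_ge; rewrite ipnormZ ger0_norm ?invr_ge0 ?ipnorm_ge0// mulVf.
Qed.

Lemma ip_linear_le y x :
  ipm y (A x) <= ipnorm ipm y * (opnorm ipn ipm A * ipnorm ipn x).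
Proof.
apply: le_trans (cauchy_schwarz _ _ _) _.
by rewrite ler_wpM2l ?ipnorm_ge0// ipnorm_linear_le_opnorm.
Qed.

(** Riesz representation of [x |-> <A x, y>] makes the set under [get] inhabited. *)
Lemma adjointP y x : ipm (A x) y = ipn x (adjoint ipn ipm A y).
Proof.
suff /getPex : exists v, forall x, ipm (A x) y = ipn x v by apply.
by apply: riesz => a u v; rewrite linearP ipDl ipZl.
Qed.

End OperatorNorm.

Lemma ipnorm_le_mx_norm (R : realType) n (ip : {dot 'cV[R]_n for idfun}) :
  exists2 C, 0 < C & forall x, ipnorm ip x <= C * `|x|.
Proof. exact: (ipnorm_linear_le_mx_norm ip idfun). Qed.

(** * Compact balls, closed functions and attained minima *)

Section Compactness.
Variable R : realType.

Lemma lipschitz_continuous (U V : normedModType R) (F : U -> V) (K : R) :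
  0 < K -> (forall x y, `|F x - F y| <= K * `|x - y|) -> continuous F.
Proof.
move=> K0 FK x; apply/cvgrPdist_lt => e e0; near=> y.
apply: le_lt_trans (FK x y) _; rewrite mulrC -ltr_pdivlMr//.
near: y; apply: cvgr_dist_lt; first exact: cvg_id.
by rewrite divr_gt0.
Unshelve. all: by end_near. Qed.

Lemma ipnorm_lipschitz n (ip : {dot 'cV[R]_n for idfun}) :
  exists2 K, 0 < K & forall x y, `|ipnorm ip x - ipnorm ip y| <= K * `|x - y|.
Proof.
have [K K0 KP] := ipnorm_le_mx_norm ip; exists K => // x y.
apply: le_trans (KP _); have := ipnorm_sub_le ip x y.
by have := ipnorm_sub_le ip y x; rewrite (ipnormB _ y x) ler_norml; lra.
Qed.

Lemma ipnorm_continuous n (ip : {dot 'cV[R]_n for idfun}) :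
  continuous (ipnorm ip : 'cV[R]_n -> R^o).
Proof. by have [K K0 /(lipschitz_continuous K0)] := ipnorm_lipschitz ip. Qed.

Lemma ip_continuous n (ip : {dot 'cV[R]_n for idfun}) u :
  continuous (ip u : 'cV[R]_n -> R^o).
Proof.
have [K K0 KP] := ipnorm_le_mx_norm ip.
have u0 := ipnorm_ge0 ip u.
apply: (@lipschitz_continuous _ _ _ ((ipnorm ip u + 1) * K)) => [|x y].
  by rewrite mulr_gt0// ltr_wpDl.
have := cauchy_schwarz ip u (x - y); have := cauchy_schwarz ip u (y - x).
rewrite (ipnormB _ y x) !ipE => h1 h2.
apply: (@le_trans _ _ (ipnorm ip u * ipnorm ip (x - y))).
  by rewrite ler_norml; lra.
rewrite -mulrA ler_pM ?ipnorm_ge0//.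
by rewrite lerDl.
Qed.

Lemma trmx_norm_le m n (M : 'M[R]_(m, n)) : `|M^T| <= `|M|.
Proof.
rewrite [leLHS]mx_normrE; apply/bigmax_leP; split=> // -[i j] _ /=; rewrite mxE.
rewrite [leRHS]mx_normrE.
exact: (le_bigmax _ (fun ij : 'I_m * 'I_n => `|M ij.1 ij.2|) (j, i)).
Qed.

Lemma trmx_continuous m n : continuous (trmx : 'M[R]_(m, n) -> 'M[R]_(n, m)).
Proof.
apply: (@lipschitz_continuous _ _ _ 1) => // x y.
by rewrite mul1r -linearB trmx_norm_le.
Qed.

Lemma ip_ball_compact n (ip : {dot 'cV[R]_n for idfun}) x0 (r : R) :
  compact [set x | ipnorm ip (x - x0) <= r].
Proof.
pose B := [set v : 'rV[R]_n | ipnorm ip (v^T - x0) <= r].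
(* [bounded_closed_compact] concerns row vectors, so the ball is presented as a continuous image
   under transposition. *)
have -> : [set x | ipnorm ip (x - x0) <= r] = trmx @` B.
  apply/seteqP; split => [x xr|_ [v vr <-]//]; exists x^T; rewrite ?trmxK//=.
  by rewrite /B/= trmxK.
apply: continuous_compact.
  by apply: continuous_subspaceT; exact: trmx_continuous.
apply: bounded_closed_compact; last first.
  have [K K0 KP] := ipnorm_lipschitz ip.
  apply: (@preimage_closed _ R^o (fun v : 'rV[R]_n => ipnorm ip (v^T - x0)) [set a | a <= r]).
    move=> v _.
    apply: (@lipschitz_continuous _ _ (fun v : 'rV[R]_n => ipnorm ip (v^T - x0) : R^o) K K0) => {v} x y.
    apply: le_trans (KP _ _) _; rewrite ler_pM2l// opprB addrA subrK -linearB.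
    exact: trmx_norm_le.
  exact: closed_le.
have [K K0 KP] := mx_norm_le_ipnorm ip.
exists (K * r + `|x0|); split => [|M Mr v /= vB]; first exact: num_real.
rewrite -(trmxK v); apply: le_trans (trmx_norm_le _) _; apply: ltW; apply: le_lt_trans Mr.
rewrite -(subrK x0 v^T); apply: le_trans (ler_normD _ _) _; rewrite lerD2r.
by apply: le_trans (KP _) _; rewrite ler_pM2l.
Qed.

(** The epigraph of [h + c] is the preimage of that of [h] under the continuous shear
    [(x, a) |-> (x, a - c x)]. *)
Lemma closed_fun_addr n (h : 'cV[R]_n -> \bar R) (c : 'cV[R]_n -> R) :
  closed_fun h -> continuous (c : 'cV[R]_n -> R^o) ->
  closed_fun (fun x => h x + (c x)%:E)%E.
Proof.
move=> hcl cc; rewrite /closed_fun.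
have -> : [set p : 'cV[R]_n * R | (h p.1 + (c p.1)%:E <= p.2%:E)%E] =
    (fun p => (p.1, p.2 - c p.1)) @^-1` [set p | (h p.1 <= p.2%:E)%E].
  by apply/seteqP; split => -[x a] /=; rewrite EFinB leeBrDr.
apply: preimage_closed => //= -[x a] _.
rewrite /continuous_at /=.
apply: (cvg_pair (G := nbhs x) (H := nbhs (a - c x)) (f := fst) (g := fun p => p.2 - c p.1)).
  exact: cvg_fst.
apply: (@cvgB _ R^o); first exact: cvg_snd.
by apply: (cvg_comp fst c _ (cc x)); exact: cvg_fst.
Qed.

Lemma closed_sublevel n (h : 'cV[R]_n -> \bar R) (a : R) :
  closed_fun h -> closed [set x | (h x <= a%:E)%E].
Proof.
move=> hcl.
apply: (@preimage_closed _ _ (fun x => (x, a)) [set p | (h p.1 <= p.2%:E)%E]) => //.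
move=> x _; rewrite /continuous_at.
apply: (cvg_pair (F := nbhs x) (G := nbhs x) (H := nbhs a) (f := id) (g := fun=> a)).
  exact: cvg_id.
exact: cvg_cst.
Qed.

(* The sublevel sets of the values taken on [K] form a filter base, and any of
   its cluster points is a minimizer. *)
Lemma closed_fun_min_compact n (h : 'cV[R]_n -> \bar R) (K : set 'cV[R]_n) :
  (forall x, h x != -oo%E) -> closed_fun h -> compact K -> K !=set0 ->
  exists2 p, K p & forall x, K x -> (h p <= h x)%E.
Proof.
move=> hNy hcl Kc [x0 Kx0].
pose S x := [set y | K y /\ (h y <= h x)%E].
have FF : ProperFilter (filter_from K S).
  apply: filter_from_proper; last by move=> x Kx; exists x; split.
  apply: filter_from_filter; first by exists x0.
  move=> x y Kx Ky; have [xy|/ltW yx] := leP (h x) (h y).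
    by exists x => // z [Kz zx]; split; split => //; exact: le_trans xy.
  by exists y => // z [Kz zy]; split; split => //; exact: le_trans yx.
have [|p [Kp clp]] := Kc (filter_from K S) FF.
  by exists x0 => // x [].
exists p => // x Kx.
case hx : (h x) (hNy x) => [a| |] // _; last by rewrite leey.
apply: (closed_sublevel hcl) => B pB.
have [|y [[Ky hyx] By]] := clp (S x) B _ pB; first by exists x.
by exists y; split => //=; rewrite -hx.
Qed.

End Compactness.

(** * Strongly convex functions: existence and growth at minimizers *)

Section StronglyConvex.
Variables (R : realType) (n : nat) (ip : {dot 'cV[R]_n for idfun}).
Implicit Types (h : 'cV[R]_n -> \bar R) (mu : R).

(* Strong convexity read on the epigraph, so that only real numbers occur. *)
Definition epi_sconvex mu h := forall x y (a b t : R), 0 <= t <= 1 ->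
  (h x <= a%:E)%E -> (h y <= b%:E)%E ->
  (h (t *: x + (1 - t) *: y)%R
     <= (t * a + (1 - t) * b
         - mu / 2 * (t * (1 - t)) * ip (x - y) (x - y))%:E)%E.

Lemma convex_epi_sconvex h : (forall x, h x != -oo%E) -> convex_fun h ->
  epi_sconvex 0 h.
Proof.
move=> hNy hcv x y a b t t01 hxa hyb; have := hcv x y t t01.
case: (h x) (hNy x) hxa => // r _; rewrite lee_fin => ra.
case: (h y) (hNy y) hyb => // s _; rewrite lee_fin => sb.
move=> /le_trans; apply.
by rewrite -!EFinM -EFinD lee_fin !mul0r subr0; nra.
Qed.

(** Rests on the identity [t |x|^2 + (1 - t) |y|^2 - |t x + (1 - t) y|^2 = t (1 - t) |x - y|^2]. *)
Lemma strongly_convex_epi_sconvex mu h : (forall x, h x != -oo%E) ->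
  strongly_convex_fun ip mu h -> epi_sconvex mu h.
Proof.
move=> hNy hcv x y a b t t01 hxa hyb; have := hcv x y t t01.
case: (h x) (hNy x) hxa => // r _; rewrite lee_fin => ra.
case: (h y) (hNy y) hyb => // s _; rewrite lee_fin => sb.
rewrite leeBlDr// => /le_trans; apply.
rewrite -!EFinB -!EFinM -!EFinD lee_fin !sqr_ipnorm !ipE (ipC ip y x).
by nra.
Qed.

(** The hypothesis on [c] is an equality, as for a quadratic of modulus [k]; it covers linear terms
    with [k = 0] and the penalty with [k = gamma]. *)
Lemma epi_sconvex_addr mu k h (c : 'cV[R]_n -> R) : epi_sconvex mu h ->
  (forall x y t, c (t *: x + (1 - t) *: y)
     = t * c x + (1 - t) * c y - k / 2 * (t * (1 - t)) * ip (x - y) (x - y)) ->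
  epi_sconvex (mu + k) (fun x => h x + (c x)%:E)%E.
Proof.
move=> hcv cP x y a b t t01; rewrite -!leeBrDr// -!EFinB => hxa hyb.
apply: le_trans (hcv _ _ _ _ _ t01 hxa hyb) _.
by rewrite lee_fin cP; lra.
Qed.

Lemma argmin_fin_num h p : proper_fun h -> argmin h p -> h p \is a fin_num.
Proof.
move=> [hNy [x hx]] hp; rewrite fin_numE hNy/= -ltey.
exact: le_lt_trans (hp x) hx.
Qed.

(** Comparing [p] with [t x + (1 - t) p] and dividing by [t] gives the bound with an extra factor
    [1 - t]. Letting [t] tend to 0 is replaced by one well-chosen [t]. *)
Lemma argmin_growth mu h p x : 0 <= mu -> proper_fun h -> epi_sconvex mu h ->
  argmin h p -> (h p + (mu / 2 * ip (x - p) (x - p))%:E <= h x)%E.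
Proof.
move=> mu0 hpr hcv hp; have := argmin_fin_num hpr hp.
case hpE : (h p) => [a| |] // _.
case hxE : (h x) (hpr.1 x) => [b| |] // _; last by rewrite leey.
rewrite -EFinD lee_fin.
set D := ip _ _; have D0 : 0 <= D by exact: ip_ge0.
have key t : 0 < t <= 1 -> a <= b - mu / 2 * (1 - t) * D.
  move=> /andP[t0 t1].
  have t01 : 0 <= t <= 1 by rewrite (ltW t0).
  have := le_trans (hp _) (hcv x p b a t t01 _ _).
  rewrite hpE hxE => /(_ (lexx _) (lexx _)); rewrite lee_fin -/D => H.
  have : t * a <= t * (b - mu / 2 * (1 - t) * D) by lra.
  by rewrite ler_pM2l.
have k1 := key 1; rewrite ltr01 lexx subrr mulr0 mul0r subr0 in k1.
have {}k1 := k1 isT.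
rewrite leNgt; apply/negP => lt.
set M := mu / 2 * D in lt.
have M0 : 0 <= M by rewrite mulr_ge0// divr_ge0.
have Mgt0 : 0 < M by lra.
(* If the bound failed by [a + M - b > 0], this [t] would make the loss [t M] only half of that gap.
   The case [t = 1] above gives [a <= b], hence [t <= 1]. *)
pose t := (a + M - b) / (2 * M).
have M2 : 0 < 2 * M by rewrite mulr_gt0.
have tM : t * M = (a + M - b) / 2 by rewrite /t; field; rewrite gt_eqF.
have t01 : 0 < t <= 1.
  rewrite /t divr_gt0 ?subr_gt0//= ler_pdivrMr// mul1r.
  by lra.
have := key t t01.
have -> : mu / 2 * (1 - t) * D = M - t * M by rewrite /M; ring.
by rewrite tM; lra.
Qed.

(* On the unit ball around a point of the domain [h] is bounded below by
   compactness; strong convexity then forces quadratic growth outside, so that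
   a sublevel set lies in a ball. *)
Lemma epi_sconvex_argmin mu h : 0 < mu -> proper_fun h -> closed_fun h ->
  epi_sconvex mu h -> exists p, argmin h p.
Proof.
move=> mu0 [hNy [x0 hx0]] hcl hcv.
have [a0 ha0] : exists a0, h x0 = a0%:E.
  by move: hx0; rewrite /dom/=; case: (h x0) (hNy x0) => // r; exists r.
pose B r := [set x | ipnorm ip (x - x0) <= r].
have Bx0 r : 0 <= r -> B r x0 by rewrite /B/= subrr ipnorm0.
have [p Bp pmin] := closed_fun_min_compact hNy hcl
  (ip_ball_compact (ip := ip) (x0 := x0) (r := 1))
  (ex_intro _ x0 (Bx0 1 ler01)).
have := pmin x0 (Bx0 1 ler01); rewrite ha0.
case hpE : (h p) (hNy p) => [m| |] // _; rewrite lee_fin => ma0.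
(* If [h x <= a0] at distance [d] from [x0], shrinking towards [x0] by [1 / d] lands in the unit
   ball, so [m <= a0 - mu / 2 (d - 1)]; this fails once [d > r]. *)
pose r := 1 + 2 * (a0 - m) / mu.
have r1 : 1 <= r by rewrite lerDl divr_ge0 ?(ltW mu0)// mulr_ge0// subr_ge0.
have out x : ~ B r x -> (h x0 <= h x)%E.
  move=> /negP; rewrite -ltNge => rx.
  set d := ipnorm ip (x - x0) in rx.
  have d1 : 1 < d by exact: le_lt_trans rx.
  have d0 : 0 < d by exact: lt_trans d1.
  rewrite ha0 leNgt; apply/negP => /ltW hxa.
  have t01 : 0 <= d^-1 <= 1 by rewrite invr_ge0 (ltW d0)/= invf_le1// ltW.
  have := hcv x x0 a0 a0 d^-1 t01 hxa; rewrite ha0 lexx => /(_ isT).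
  set w := d^-1 *: x + (1 - d^-1) *: x0.
  have wE : w - x0 = d^-1 *: (x - x0).
    by rewrite /w scalerBl scale1r scalerBr addrA addrAC addrK.
  have Bw : B 1 w by rewrite /B/= wE ipnormZ ger0_norm ?invr_ge0 ?(ltW d0)// mulVf ?gt_eqF.
  move=> /(le_trans (pmin w Bw)); rewrite hpE lee_fin -sqr_ipnorm -/d.
  have -> : d^-1 * a0 + (1 - d^-1) * a0 - mu / 2 * (d^-1 * (1 - d^-1)) * d ^+ 2
      = a0 - mu / 2 * (d - 1) by field; rewrite gt_eqF.
  move: rx; rewrite /r -ltrBrDl ltr_pdivrMr//.
  by lra.
have [q Bq qmin] := closed_fun_min_compact hNy hcl
  (ip_ball_compact (ip := ip) (x0 := x0) (r := r))
  (ex_intro _ x0 (Bx0 r (le_trans ler01 r1))).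
exists q => x; have [/qmin//|/out] := pselect (B r x).
by apply: le_trans; apply: qmin; apply: Bx0; exact: le_trans r1.
Qed.

Lemma proper_fun_addr h (c : 'cV[R]_n -> R) : proper_fun h ->
  proper_fun (fun x => h x + (c x)%:E)%E.
Proof.
move=> [hNy [x hx]]; split; last by exists x; rewrite /dom/= lte_add_pinfty// ltry.
by move=> y; case: (h y) (hNy y).
Qed.

(** Existence and quadratic growth for [h + c], with [c] moved to the other side so as to bound [h]
    itself. Only [mu + k] must be positive: the curvature may come from [h] or from [c]. *)
Lemma argmin_perturbed mu k h (c : 'cV[R]_n -> R) :
  0 < mu + k -> proper_fun h -> closed_fun h -> epi_sconvex mu h ->
  continuous (c : 'cV[R]_n -> R^o) ->
  (forall x y t, c (t *: x + (1 - t) *: y)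
     = t * c x + (1 - t) * c y - k / 2 * (t * (1 - t)) * ip (x - y) (x - y)) ->
  let p := get (argmin (fun x => h x + (c x)%:E)%E) in
  h p \is a fin_num /\
  forall x, ((fine (h p) + c p - c x + (mu + k) / 2 * ip (x - p) (x - p))%:E
    <= h x)%E.
Proof.
move=> muk0 hpr hcl hcv cc cP /=; set hc := fun x => _; set p := get _.
have hcpr : proper_fun hc by exact: proper_fun_addr.
have hccv : epi_sconvex (mu + k) hc by exact: epi_sconvex_addr.
have pmin : argmin hc p.
  apply: getPex; apply: (epi_sconvex_argmin muk0) => //.
  exact: closed_fun_addr.
have hpfin : h p \is a fin_num.
  by have := argmin_fin_num hcpr pmin; rewrite /hc fin_numD => /andP[].
split=> // x; have := argmin_growth x (ltW muk0) hcpr hccv pmin.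
rewrite /hc -{1}(fineK hpfin) -!EFinD -leeBlDr// -EFinB.
by congr (_%:E <= _)%E; lra.
Qed.

End StronglyConvex.

(** The upper limit is an infimum over neighbourhoods, so the supremum over pairs of distinct points
    of one unit ball bounds it. A one-sided estimate suffices, since [y] and [y'] can be swapped. *)
Lemma strictly_continuous_locally_lipschitz (R : realType) n
    (ip : {dot 'cV[R]_n for idfun}) (F : 'cV[R]_n -> R) :
  (forall x0, exists K, forall y y', ipnorm ip (y - x0) <= 1 ->
    ipnorm ip (y' - x0) <= 1 -> F y' - F y <= K * ipnorm ip (y' - y)) ->
  strictly_continuous ip F.
Proof.
move=> FK x0; have [K KP] := FK x0.
pose B := [set x | ipnorm ip (x - x0) <= 1].
have x0B : nbhs x0 B.
  have [C C0 CP] := ipnorm_le_mx_norm ip; near=> x.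
  apply: le_trans (CP _) _; rewrite mulrC -ler_pdivlMr// distrC ltW//.
  near: x; apply: cvgr_dist_lt; first exact: cvg_id.
  by rewrite divr_gt0.
pose V := [set p : 'cV[R]_n * 'cV[R]_n | [/\ B p.1, B p.2 & p.1 <> p.2]].
rewrite /strictly_continuous_at /limf_esup.
apply: (@le_lt_trans _ _ K%:E); last exact: ltry.
apply: le_trans.
  apply: ereal_inf_lbound; exists V; last reflexivity.
  by exists (B, B) => // p [Bp1 Bp2] p12; split.
apply: ge_ereal_sup => _ [p [Bp1 Bp2 p12] <-]; rewrite lee_fin.
have p_gt0 : 0 < ipnorm ip (p.2 - p.1).
  rewrite lt_def ipnorm_ge0 andbT; apply/eqP => /ipnorm_eq0/eqP.
  by rewrite subr_eq0 => /eqP/esym.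
rewrite ler_pdivrMr// ler_norml KP// andbT lerNl opprB ipnormB.
exact: KP.
Unshelve. all: by end_near. Qed.

(** * Optimality conditions for the two minimizers *)

Section Minimizers.
Variables (R : realType) (n m : nat).
Variables (ipn : {dot 'cV[R]_n for idfun}) (ipm : {dot 'cV[R]_m for idfun}).
Variable A : {linear 'cV[R]_n -> 'cV[R]_m}.
Variables (f : 'cV[R]_n -> \bar R) (g : 'cV[R]_m -> \bar R) (mu gamma : R).
Hypotheses (f_proper : proper_fun f) (f_closed : closed_fun f).
Hypotheses (mu_gt0 : 0 < mu) (f_sconvex : strongly_convex_fun ipn mu f).
Hypotheses (g_proper : proper_fun g) (g_closed : closed_fun g).
Hypotheses (g_convex : convex_fun g) (gamma_gt0 : 0 < gamma).

Local Notation "''[' u , v ]" := (ipm u v).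
Local Notation "`|[ u ]|" := (ipnorm ipm u) (format "`|[ u ]|").
Local Notation nA := (opnorm ipn ipm A).
Local Notation x_ := (xmin ipm A f).
Local Notation u_ y := (A (x_ y)).
Local Notation z_ := (zmin ipm A f g gamma).
Local Notation r_ := (residual ipm A f g gamma).
Local Notation T_ := (Tmap ipm A f g gamma).

(** The perturbation [<y, A x>] is linear, so the objective keeps the modulus [mu] of [f]. *)
Lemma xmin_growth y : f (x_ y) \is a fin_num /\
  forall x, ((fine (f (x_ y)) + '[y, u_ y] - '[y, A x]
    + mu / 2 * ipn (x - x_ y) (x - x_ y))%:E <= f x)%E.
Proof.
have := @argmin_perturbed R n ipn mu 0 f (fun x => '[y, A x]).
rewrite addr0; apply=> //.
- exact: strongly_convex_epi_sconvex f_proper.1 f_sconvex.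
- have -> : (fun x => '[y, A x]) = ipn (adjoint ipn ipm A y).
    by apply/funext => x; rewrite ipC (adjointP ipn) ipC.
  exact: ip_continuous.
- by move=> x x' t; rewrite linearP linearZ !ipE; ring.
Qed.

(** Here the curvature comes from the penalty alone. The growth term [gamma / 2 |w - z|^2] cancels
    the quadratic part of [c z - c w] exactly, leaving an affine minorant of [g] with slope
    [T_ y]. *)
Lemma zmin_growth y : g (z_ y) \is a fin_num /\
  forall w, ((fine (g (z_ y)) + '[T_ y, w - z_ y])%:E <= g w)%E.
Proof.
have fx := (xmin_growth y).1.
pose c (z : 'cV[R]_m) := fine (f (x_ y)) + '[y, u_ y - z] + gamma / 2 * `|[u_ y - z]| ^+ 2.
(* The finite constant [f (x_ y)] is absorbed into the real perturbation [c]. *)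
have zE : z_ y = get (argmin (fun z => g z + (c z)%:E)%E).
  rewrite /zmin; congr (get (argmin _)); apply/funext => z.
  rewrite /aug_lagrangian /c !EFinD -{1}(fineK fx) !addeA.
  by rewrite (addeC _ (g z)).
have [] := @argmin_perturbed R m ipm 0 gamma g c.
- by rewrite add0r.
- by [].
- by [].
- exact: convex_epi_sconvex g_proper.1 g_convex.
- have cB : continuous ((fun z => u_ y - z) : 'cV[R]_m -> 'cV[R]_m).
    apply: (@lipschitz_continuous _ _ _ _ 1) => // z w.
    by rewrite mul1r distrC opprB addrC addrA subrK distrC.
  have c1 : continuous (fun z : 'cV[R]_m => '[y, u_ y - z] : R^o).
    by move=> z; apply: continuous_comp (cB z) _; exact: ip_continuous.
  have c2 : continuous (fun z : 'cV[R]_m => `|[u_ y - z]| : R^o).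
    by move=> z; apply: continuous_comp (cB z) _; exact: ipnorm_continuous.
  move=> z; rewrite /continuous_at /c.
  apply: (@cvgD _ R^o _ (nbhs z)).
    by apply: (@cvgD _ R^o _ (nbhs z)); [exact: cvg_cst|exact: c1].
  apply: (@cvgM _ _ (nbhs z)); first exact: cvg_cst.
  by under eq_fun do rewrite expr2; rewrite expr2; apply: (@cvgM _ _ (nbhs z)); exact: c2.
- move=> z w t; rewrite /c !sqr_ipnorm !ipE (ipC _ (u_ y) z) (ipC _ (u_ y) w).
  by rewrite (ipC _ w z); field.
rewrite -zE add0r => gz H; split=> // w; apply: le_trans (H w).
rewrite lee_fin /c !sqr_ipnorm /Tmap /residual !ipE.
rewrite (ipC _ (u_ y) (z_ y)) (ipC _ (u_ y) w) (ipC _ w (z_ y)).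
by lra.
Qed.

End Minimizers.

(* The two minimizers enter only through their optimality conditions; keeping
   them abstract stops unification from unfolding [get]. *)
Section DualEnvelope.
Variables (R : realType) (n m : nat).
Variables (ipn : {dot 'cV[R]_n for idfun}) (ipm : {dot 'cV[R]_m for idfun}).
Variable A : {linear 'cV[R]_n -> 'cV[R]_m}.
Variables (f : 'cV[R]_n -> \bar R) (g : 'cV[R]_m -> \bar R) (mu gamma : R).
Variables (x_ : 'cV[R]_m -> 'cV[R]_n) (z_ : 'cV[R]_m -> 'cV[R]_m).

Local Notation "''[' u , v ]" := (ipm u v).
Local Notation "`|[ u ]|" := (ipnorm ipm u) (format "`|[ u ]|").
Local Notation nA := (opnorm ipn ipm A).
Local Notation u_ y := (A (x_ y)).

Let r_ y := u_ y - z_ y.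
Let T_ y := y + gamma *: r_ y.
Let psi_gamma y := (- aug_lagrangian ipm A f g gamma (x_ y) (z_ y) y)%E.

Hypotheses (mu_gt0 : 0 < mu) (gamma_gt0 : 0 < gamma).
Hypotheses (f_gtNy : forall x, f x != -oo%E) (g_gtNy : forall z, g z != -oo%E).
Hypothesis xmin_growth : forall y, f (x_ y) \is a fin_num /\
  forall x, ((fine (f (x_ y)) + '[y, u_ y] - '[y, A x]
    + mu / 2 * ipn (x - x_ y) (x - x_ y))%:E <= f x)%E.
Hypothesis zmin_growth : forall y, g (z_ y) \is a fin_num /\
  forall w, ((fine (g (z_ y)) + '[T_ y, w - z_ y])%:E <= g w)%E.

(** * Conjugates and the two inequalities between [psi] and [psi_gamma] *)

Let F y : R := - (fine (f (x_ y)) + '[y, u_ y]).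

(** The part of [psi_gamma] that depends on [g]: the maximum over [z] of
    [<y, z> - g z - gamma / 2 |u_ y - z|^2], attained at [z_ y]. *)
Let M y : R :=
  '[y, z_ y] - fine (g (z_ y)) - gamma / 2 * `|[u_ y - z_ y]| ^+ 2.

(** Smoothness constant of [F], and Lipschitz constant of [y |-> A (x_ y)]. *)
Let L : R := nA ^+ 2 / mu.

Let L_ge0 : 0 <= L. Proof. by rewrite divr_ge0 ?sqr_ge0// ltW. Qed.

Lemma conjugate_f y :
  conjugate_fun ipn f (- adjoint ipn ipm A y)%R = (F y)%:E.
Proof.
have [fx fmin] := xmin_growth y; apply/eqP; rewrite eq_le; apply/andP; split.
  apply: ge_ereal_sup => _ [x _ <-]; have := fmin x.
  case: (f x) (f_gtNy x) => [r| |] // _; last by rewrite leNye.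
  rewrite -EFinB !lee_fin /F ipNr -(adjointP ipn) (ipC _ (A x)).
  have : 0 <= mu / 2 * ipn (x - x_ y) (x - x_ y).
    by rewrite mulr_ge0 ?ip_ge0 ?divr_ge0 ?(ltW mu_gt0).
  by lra.
apply: ereal_sup_ubound; exists (x_ y) => //.
rewrite -(fineK fx) -EFinB /F ipNr -(adjointP ipn) (ipC _ (u_ y)).
by congr (_%:E); ring.
Qed.

Lemma conjugate_g_ge y z : ('[z, y]%:E - g z <= conjugate_fun ipm g y)%E.
Proof. by apply: ereal_sup_ubound; exists z. Qed.

(* Optimality of [z_ y] says that [T_ y] is a subgradient of [g] there. *)
Lemma conjugate_g_Tmap y :
  conjugate_fun ipm g (T_ y) = ('[z_ y, T_ y] - fine (g (z_ y)))%:E.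
Proof.
have [gz gmin] := zmin_growth y; apply/eqP; rewrite eq_le; apply/andP; split.
  apply: ge_ereal_sup => _ [w _ <-]; have := gmin w.
  case: (g w) (g_gtNy w) => [r| |] // _; last by rewrite leNye.
  rewrite -EFinB !lee_fin ipDr ipNr (ipC _ w) (ipC _ (z_ y)).
  by lra.
by rewrite EFinB fineK// conjugate_g_ge.
Qed.

Lemma psi_gammaE y : psi_gamma y = (F y + M y)%:E.
Proof.
have [fx _] := xmin_growth y; have [gz _] := zmin_growth y.
rewrite /psi_gamma /aug_lagrangian -(fineK fx) -(fineK gz) -!EFinD -EFinN /F /M.
by congr (_%:E); rewrite ipDr ipNr; ring.
Qed.

Lemma psi_gamma_fin_num y : psi_gamma y \is a fin_num.
Proof. by rewrite psi_gammaE. Qed.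

Lemma psi_gamma_le y :
  (psi_gamma y
    <= psi ipn ipm A f g y - (gamma / 2 * `|[r_ y]| ^+ 2)%:E)%E.
Proof.
have [gz _] := zmin_growth y.
rewrite psi_gammaE /psi conjugate_f leeBrDr// -EFinD.
apply: le_trans (leeD2l _ (conjugate_g_ge y (z_ y))).
by rewrite -(fineK gz) -EFinB -EFinD lee_fin /M /r_ (ipC _ (z_ y)); lra.
Qed.

(** Growth at [x_ y], tested at [x_ y'], leaves a cross term in [A (x_ y' - x_ y)]; Young's
    inequality trades it for the growth term and [L / 2 |y' - y|^2]. *)
Lemma F_le y y' :
  F y' <= F y - '[y' - y, u_ y] + L / 2 * `|[y' - y]| ^+ 2.
Proof.
have [fx' _] := xmin_growth y'; have [_ /(_ (x_ y'))] := xmin_growth y.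
rewrite -(fineK fx') lee_fin -sqr_ipnorm => H.
have H2 := ip_linear_le ipn ipm A (- (y' - y)) (x_ y' - x_ y).
rewrite ipnormN linearB in H2.
have : `|[y' - y]| * (nA * ipnorm ipn (x_ y' - x_ y))
    <= mu / 2 * ipnorm ipn (x_ y' - x_ y) ^+ 2 + L / 2 * `|[y' - y]| ^+ 2.
  set d := ipnorm ipn _; set e := `|[_]|.
  (* This square is Young's inequality with weights [mu] and [L = nA^2 / mu]. *)
  have : 0 <= (mu * d - nA * e) ^+ 2 / (2 * mu).
    by rewrite divr_ge0 ?sqr_ge0// mulr_ge0// ltW.
  have -> : (mu * d - nA * e) ^+ 2 / (2 * mu)
      = mu / 2 * d ^+ 2 + L / 2 * e ^+ 2 - e * (nA * d).
    by rewrite /L; field; rewrite gt_eqF.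
  by rewrite subr_ge0.
move: H H2; rewrite /F !ipE; lra.
Qed.

(** With [T_ y - y = gamma r], the linear term of the upper model and the term [gamma <z, r>] of the
    conjugate add up to [- gamma |r|^2]. Half of it is the penalty in [M]; the other half remains as
    the gain. *)
Lemma psi_gamma_ge y :
  (psi ipn ipm A f g (T_ y)
     + (gamma / 2 * (1 - gamma * nA ^+ 2 / mu) * `|[r_ y]| ^+ 2)%:E
   <= psi_gamma y)%E.
Proof.
rewrite psi_gammaE /psi conjugate_f conjugate_g_Tmap -!EFinD lee_fin.
have := F_le y (T_ y).
have -> : T_ y - y = gamma *: r_ y by rewrite /T_ addrC addKr.
rewrite ipnormZ (gtr0_norm gamma_gt0) exprMn.
have -> : gamma * nA ^+ 2 / mu = gamma * L by rewrite /L mulrA.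
rewrite /M /T_ /r_ !sqr_ipnorm !ipE (ipC _ (z_ y) y) (ipC _ (z_ y) (u_ y)).
by lra.
Qed.

(** * Lipschitz dependence on [y] and strict continuity *)

Lemma u_lipschitz y y' : `|[u_ y' - u_ y]| <= L * `|[y' - y]|.
Proof.
have [fx xmin1] := xmin_growth y; have [fx' xmin2] := xmin_growth y'.
have := xmin1 (x_ y'); have := xmin2 (x_ y).
rewrite -{1}(fineK fx) -{2}(fineK fx') !lee_fin -!sqr_ipnorm.
rewrite (ipnormB _ (x_ y)); set d := ipnorm ipn _ => h1 h2.
have := ip_linear_le ipn ipm A (- (y' - y)) (x_ y' - x_ y).
rewrite -/d ipnormN linearB !ipE => h3.
have d0 : 0 <= d by exact: ipnorm_ge0.
have e0 : 0 <= `|[y' - y]| by exact: ipnorm_ge0.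
have a0 : 0 <= nA by exact: opnorm_ge0.
(* The two growth inequalities, each tested at the other minimizer, add up to
   [mu d^2 <= - <y' - y, u' - u>]. *)
have {h1 h2 h3} h : d * (mu * d) <= d * (nA * `|[y' - y]|) by lra.
have {}h : mu * d <= nA * `|[y' - y]|.
  have [d00|dN0] := eqVneq d 0; first by rewrite d00 mulr0 mulr_ge0.
  by rewrite -(ler_pM2l (x := d))// lt_def dN0.
rewrite -linearB; apply: le_trans (ipnorm_linear_le_opnorm ipn _ _ _) _; rewrite -/d.
rewrite /L mulrAC ler_pdivlMr// expr2 -!mulrA (mulrC d) ler_wpM2l//.
Qed.

(** Subgradients are monotone: [<T_ y' - T_ y, z_ y' - z_ y> >= 0]. Since [T_] contains
    [- gamma z_], this bounds [gamma |z_ y' - z_ y|^2] by terms linear in [z_ y' - z_ y]. *)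
Lemma z_lipschitz y y' :
  `|[z_ y' - z_ y]| <= (gamma^-1 + L) * `|[y' - y]|.
Proof.
have [gz zmin1] := zmin_growth y; have [gz' zmin2] := zmin_growth y'.
have := zmin1 (z_ y'); have := zmin2 (z_ y).
rewrite -{1}(fineK gz) -{2}(fineK gz') !lee_fin.
set e := `|[z_ y' - z_ y]|; have e0 : 0 <= e by exact: ipnorm_ge0.
have E : '[T_ y', z_ y - z_ y'] + '[T_ y, z_ y' - z_ y]
    = gamma * e ^+ 2 - '[y' - y, z_ y' - z_ y]
      - gamma * '[u_ y' - u_ y, z_ y' - z_ y].
  by rewrite sqr_ipnorm /T_ /r_ !ipE; ring.
have := cauchy_schwarz ipm (y' - y) (z_ y' - z_ y).
have := cauchy_schwarz ipm (u_ y' - u_ y) (z_ y' - z_ y).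
rewrite -/e; set p := '[y' - y, _] in E *; set q := '[u_ y' - _, _] in E *.
move=> q1 p1 h2 h1.
have ul := u_lipschitz y y'.
have d0 : 0 <= `|[y' - y]| by exact: ipnorm_ge0.
have q2 : gamma * q <= gamma * (L * `|[y' - y]| * e).
  rewrite ler_pM2l//; apply: le_trans q1 _.
  by rewrite ler_wpM2r.
have h : e * (gamma * e) <= e * (gamma * ((gamma^-1 + L) * `|[y' - y]|)).
  rewrite mulrDl mulrDr mulVKf ?gt_eqF//.
  by nra.
have [e00|eN0] := eqVneq e 0.
  by rewrite e00 mulr_ge0// addr_ge0// invr_ge0 ltW.
by move: h; rewrite !ler_pM2l// lt_def eN0.
Qed.

(** Maximality of [z_ y], tested at [z_ y']: after the subgradient inequality the slack is
    [gamma / 2 |z_ y' - z_ y|^2]. *)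
Lemma M_ge y y' :
  M y >= '[y, z_ y'] - fine (g (z_ y')) - gamma / 2 * `|[u_ y - z_ y']| ^+ 2.
Proof.
have [gz' _] := zmin_growth y'; have [gz /(_ (z_ y'))] := zmin_growth y.
rewrite -{1}(fineK gz') lee_fin /T_ /r_ /M !sqr_ipnorm.
have : 0 <= gamma / 2 * '[z_ y' - z_ y, z_ y' - z_ y].
  by rewrite mulr_ge0 ?ip_ge0 ?divr_ge0 ?(ltW gamma_gt0).
rewrite !ipE (ipC _ (u_ y) (z_ y)) (ipC _ (u_ y) (z_ y')) (ipC _ (z_ y') (z_ y)).
by lra.
Qed.

(** [F] changes by at most [- <y' - y, u_ y'>], and testing [M y] at [z_ y'] adds [<y' - y, z_ y'>];
    together they give [- <y' - y, r_ y'>]. The rest is the change of the penalty as [u_] moves. *)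
Lemma psi_gamma_lipschitz_step y y' :
  F y' + M y' - (F y + M y) <= `|[y' - y]| * (`|[r_ y']|
    + gamma / 2 * L * (2 * `|[r_ y']| + L * `|[y' - y]|)).
Proof.
have [_ fmin] := xmin_growth y.
have [fx' _] := xmin_growth y'.
have FF : F y' - F y <= - '[y' - y, u_ y'].
  have := fmin (x_ y'); rewrite -(fineK fx') lee_fin /F !ipE.
  have : 0 <= mu / 2 * ipn (x_ y' - x_ y) (x_ y' - x_ y).
    by rewrite mulr_ge0 ?ip_ge0 ?divr_ge0 ?(ltW mu_gt0).
  by rewrite !ipE; lra.
have := M_ge y y'.
have E : gamma / 2 * `|[u_ y - z_ y']| ^+ 2
    = gamma / 2 * (`|[r_ y']| ^+ 2 - 2 * '[u_ y' - u_ y, r_ y']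
        + `|[u_ y' - u_ y]| ^+ 2).
  rewrite !sqr_ipnorm /r_ !ipE.
  by rewrite (ipC _ (u_ y) (z_ y')) (ipC _ (u_ y) (u_ y')) (ipC _ (u_ y') (z_ y')); ring.
rewrite E => MM.
have c1 := cauchy_schwarz ipm (- (y' - y)) (r_ y').
rewrite ipnormN in c1.
have c2 := cauchy_schwarz ipm (- (u_ y' - u_ y)) (r_ y').
rewrite ipnormN in c2.
have ul := u_lipschitz y y'.
have rE : '[y' - y, u_ y'] = '[y' - y, r_ y'] + '[y' - y, z_ y'].
  by rewrite -ipDr /r_ subrK.
have d0 : 0 <= `|[y' - y]| by exact: ipnorm_ge0.
have v0 : 0 <= `|[u_ y' - u_ y]| by exact: ipnorm_ge0.
have r0 : 0 <= `|[r_ y']| by exact: ipnorm_ge0.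
have l0 := L_ge0.
have v2 : `|[u_ y' - u_ y]| ^+ 2 <= (L * `|[y' - y]|) ^+ 2.
  by rewrite ler_pXn2r// nnegrE (mulr_ge0 l0 d0).
have vr : `|[u_ y' - u_ y]| * `|[r_ y']| <= L * `|[y' - y]| * `|[r_ y']|.
  by rewrite ler_wpM2r.
move: MM FF; rewrite /M rE.
rewrite -/(r_ y').
move=> MM FF.
rewrite !ipNl in c1 c2.
have k : gamma / 2 * (- 2 * '[u_ y' - u_ y, r_ y'] + `|[u_ y' - u_ y]| ^+ 2)
   <= gamma / 2 * (2 * (L * `|[y' - y]| * `|[r_ y']|) + (L * `|[y' - y]|) ^+ 2).
  by rewrite ler_pM2l ?divr_gt0//; lra.
have zE : '[y' - y, z_ y'] = '[y', z_ y'] - '[y, z_ y'] by rewrite ipDl ipNl.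
by move: MM FF; rewrite zE; lra.
Qed.

Lemma psi_gamma_strictly_continuous :
  strictly_continuous ipm (fine \o psi_gamma).
Proof.
apply: strictly_continuous_locally_lipschitz => y0.
(* Bounds the residual on the unit ball around [y0], where [u_] moves by at most [L] and [z_] by at
   most [gamma^-1 + L]. The 2 in [L * 2] below is the diameter of that ball. *)
pose B := `|[r_ y0]| + L + (gamma^-1 + L).
exists (B + gamma / 2 * L * (2 * B + L * 2)) => y y' yy0 y'y0.
rewrite /= !psi_gammaE /=; apply: le_trans (psi_gamma_lipschitz_step y y') _.
rewrite mulrC ler_wpM2r ?ipnorm_ge0//.
have l0 := L_ge0.
have rB : `|[r_ y']| <= B.
  have rE : r_ y' = r_ y0 + (u_ y' - u_ y0) - (z_ y' - z_ y0).
    rewrite /r_; move: (u_ y') (u_ y0) (z_ y') (z_ y0) => a b c d.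
    by apply/matrixP => i j; rewrite !mxE; ring.
  rewrite rE; apply: le_trans (ler_ipnormB _ _ _) _; rewrite lerD//.
    apply: le_trans (ipnormD _ _ _) _; rewrite lerD2l.
    by apply: le_trans (u_lipschitz _ _) _; rewrite ler_piMr.
  apply: le_trans (z_lipschitz _ _) _.
  by rewrite ler_piMr// addr_ge0// invr_ge0 ltW.
have dB : `|[y' - y]| <= 2.
  have -> : y' - y = (y' - y0) - (y - y0) by rewrite opprB addrA subrK.
  by apply: le_trans (ler_ipnormB _ _ _) _; lra.
have g0 : 0 <= gamma / 2 * L by rewrite (mulr_ge0 _ l0)// divr_ge0// ltW.
apply: lerD => //; apply: ler_wpM2l => //.
by apply: lerD; apply: ler_wpM2l.
Qed.

End DualEnvelope.

Theorem mainTheorem2 (R : realType) (n m : nat)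
    (ipn : {dot 'cV[R]_n for idfun}) (ipm : {dot 'cV[R]_m for idfun})
    (A : {linear 'cV[R]_n -> 'cV[R]_m})
    (f : 'cV[R]_n -> \bar R) (g : 'cV[R]_m -> \bar R) (mu : R)
    (f_proper : proper_fun f) (f_closed : closed_fun f)
    (mu_gt0 : 0 < mu) (f_sconvex : strongly_convex_fun ipn mu f)
    (g_proper : proper_fun g) (g_closed : closed_fun g)
    (g_convex : convex_fun g)
    (dom_fg : (A @` dom f) `&` dom g !=set0)
    (gamma : R) (gamma_gt0 : 0 < gamma) :
  let psi := psi ipn ipm A f g in
  let psi_gamma := psi_env ipm A f g gamma in
  let r := residual ipm A f g gamma in
  let T := Tmap ipm A f g gamma in
  (forall y, psi_gamma y \is a fin_num) /\
  strictly_continuous ipm (fine \o psi_gamma) /\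
  (forall y, (psi_gamma y <= psi y - (gamma / 2 * ipnorm ipm (r y) ^+ 2)%:E)%E) /\
  (forall y, (psi_gamma y >= psi (T y)
     + (gamma / 2 * (1 - gamma * opnorm ipn ipm A ^+ 2 / mu)
          * ipnorm ipm (r y) ^+ 2)%:E)%E) /\
  ((gamma%:E < mu%:E / (opnorm ipn ipm A ^+ 2)%:E)%E ->
   ereal_inf (range psi_gamma) = ereal_inf (range psi) /\
   argmin psi_gamma = argmin psi).
Proof.
move=> psi psi_gamma r T.
have xP := xmin_growth ipm A f_proper f_closed mu_gt0 f_sconvex.
have zP := zmin_growth ipm A f_proper f_closed mu_gt0 f_sconvex
  g_proper g_closed g_convex gamma_gt0.
have upper y : (psi_gamma y
    <= psi y - (gamma / 2 * ipnorm ipm (r y) ^+ 2)%:E)%E.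
  exact: psi_gamma_le mu_gt0 f_proper.1 xP zP y.
have lower y : (psi (T y)
     + (gamma / 2 * (1 - gamma * opnorm ipn ipm A ^+ 2 / mu)
          * ipnorm ipm (r y) ^+ 2)%:E <= psi_gamma y)%E.
  exact: psi_gamma_ge mu_gt0 gamma_gt0 f_proper.1 g_proper.1 xP zP y.
have fin y : psi_gamma y \is a fin_num by exact: psi_gamma_fin_num xP zP y.
split=> //; split.
  exact: psi_gamma_strictly_continuous mu_gt0 gamma_gt0 xP zP.
do 2!split=> //; move=> gamma_lt.
have coef : 0 < 1 - gamma * opnorm ipn ipm A ^+ 2 / mu.
  rewrite subr_gt0 ltr_pdivrMr// mul1r; move: gamma_lt.
  (* If the operator norm is 0, the extended quotient is [+oo] and the coefficient is 1. *)
  rewrite inver; case: eqP => [->|/eqP nA0]; first by rewrite mulr0.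
  by rewrite -EFinM lte_fin ltr_pdivlMr// lt_def nA0 sqr_ge0.
have le_psi y : (psi_gamma y <= psi y)%E.
  apply: le_trans (upper y) _; rewrite leeBlDr// leeDl// lee_fin.
  by rewrite mulr_ge0 ?sqr_ge0// divr_ge0 ?(ltW gamma_gt0).
have psiT_le y : (psi (T y) <= psi_gamma y)%E.
  apply: le_trans (lower y); rewrite leeDl// lee_fin.
  rewrite mulr_ge0 ?sqr_ge0// mulr_ge0 ?(ltW coef)//.
  by rewrite divr_ge0// ltW.
split.
  apply/eqP; rewrite eq_le; apply/andP; split.
    apply: le_ereal_inf_tmp => _ [y _ <-].
    by apply: le_trans (le_psi y); apply: ereal_inf_lbound; exists y.
  apply: le_ereal_inf_tmp => _ [y _ <-].
  by apply: le_trans (psiT_le y); apply: ereal_inf_lbound; exists (T y).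
apply/seteqP; split => y ymin w.
  have r0 : r y = 0.
    (* The chain [psi (T y) <= psi_gamma y <= psi_gamma (T y) <= psi (T y)] collapses, so (ii) with
       its positive coefficient forces [r y = 0]. *)
    have psiT_eq : psi (T y) = psi_gamma y.
      by apply/eqP; rewrite eq_le psiT_le (le_trans (ymin (T y)) (le_psi _)).
    have := lower y; rewrite psiT_eq -(fineK (fin y)) -EFinD lee_fin gerDl.
    rewrite pmulr_rle0 ?mulr_gt0 ?divr_gt0// => r_le0.
    apply: (@ipnorm_eq0 _ _ ipm); apply/eqP.
    by rewrite -sqrf_eq0 eq_le r_le0 sqr_ge0.
  have <- : T y = y by rewrite /T /Tmap -/(r y) r0 scaler0 addr0.
  by apply: le_trans (psiT_le y) _; exact: le_trans (ymin w) (le_psi w).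
(* Conversely, [psi_gamma y <= psi y <= psi (T w) <= psi_gamma w]. *)
by apply: le_trans (le_psi y) _; apply: le_trans (ymin (T w)) (psiT_le w).
Qed.
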